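(* Let $G$ be a connected graph on $n$ vertices. If $G$ contains $\left\lfloor\frac{n-1}3\right\rfloor$ pairwise vertex-disjoint paths of length $2$, then $\mathrm{edim}(S(G))\le\left\lceil\frac{2n-2}{3}\right\rceil$.
   Context: Graphs are finite, simple and undirected. A path of length $2$ in $G$ is a (not necessarily induced) path with two edges and three vertices. The subdivision graph $S(G)$ is obtained from $G$ by subdividing every edge exactly once, i.e. every edge $uv$ is removed and replaced by a new vertex $w$ together with the edges $uw$ and $wv$. For a connected graph $H$, $d_H(x,y)$ is the length of a shortest $x$-$y$ path, and for an edge $e=xy\in E(H)$ and a vertex $v\in V(H)$, $d_H(e,v)=\min\{d_H(x,v),d_H(y,v)\}$. A set $S\subseteq V(H)$ is an edge metric generator for $H$ if for any two distinct edges $e,f\in E(H)$ there is $v\in S$ with $d_H(e,v)\neq d_H(f,v)$; the edge metric dimension $\mathrm{edim}(H)$ is the minimum cardinality of an edge metric generator for $H$. *)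

(* Defs.v *)
From mathcomp Require Import all_boot.

Set Implicit Arguments.
Unset Strict Implicit.
Unset Printing Implicit Defensive.

Record sgraph := SGraph {
  svertex :> finType;
  adj : rel svertex;
  adj_sym : symmetric adj;
  adj_irrefl : irreflexive adj }.

Arguments adj {s} x y.

Definition connected_graph (G : sgraph) : Prop :=
  0 < #|G| /\ forall x y : G, connect adj x y.

(* A path is given by the sequence of its vertices, so its length is          *)
(* (size s).-1.                                                               *)
Definition gpath (G : sgraph) (s : seq G) : bool := uniq s && sorted adj s.

Definition edges (G : sgraph) : {set {set G}} :=
  [set [set p.1; p.2] | p in [pred p : G * G | adj p.1 p.2]].

(* The least k such that a path of length k joins x to y; paths have fewer    *)
(* than #|G| edges, and the value is #|G| when there is no path.              *)
Definition dist (G : sgraph) (x y : G) : nat :=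
  find (fun k => [exists p : k.-tuple G, gpath (x :: p) && (last x p == y)])
       (iota 0 #|G|).

(* Distances are at most #|G|, so the neutral element #|G| does not affect    *)
(* the minimum over the two ends of an edge (edist2).                         *)
Definition edist (G : sgraph) (e : {set G}) (v : G) : nat :=
  \big[minn/#|G|]_(x in e) dist x v.

Definition edge_metric_generator (G : sgraph) (S : {set G}) : bool :=
  [forall e in edges G, forall f in edges G,
     (e != f) ==> [exists v in S, edist e v != edist f v]].

(* The whole vertex set is an edge metric generator, so the neutral element   *)
(* #|G| does not affect the minimum (edimP).                                  *)
Definition edim (G : sgraph) : nat :=
  \big[minn/#|G|]_(S : {set G} | edge_metric_generator S) #|S|.

(* The new vertex subdividing an edge is represented by that edge.            *)
Section Subdivision.
Variable G : sgraph.

Definition subdiv_vertex : finType := (G + {e : {set G} | e \in edges G})%type.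

Definition subdiv_adj (a b : subdiv_vertex) : bool :=
  match a, b with
  | inl u, inr e => u \in val e
  | inr e, inl u => u \in val e
  | _, _ => false
  end.

Fact subdiv_adj_sym : symmetric subdiv_adj.
Proof. by case=> [u|e] [v|f]. Qed.

Fact subdiv_adj_irrefl : irreflexive subdiv_adj.
Proof. by case. Qed.

Definition subdivision : sgraph := SGraph subdiv_adj_sym subdiv_adj_irrefl.

End Subdivision.

Definition ceil_div (m d : nat) : nat := (m + d.-1) %/ d.

Lemma dist_le (G : sgraph) (x y : G) : dist x y <= #|G|.
Proof. by rewrite -[leqRHS](size_iota 0) find_size. Qed.

Lemma bigminn_le (I : finType) (P : pred I) (F : I -> nat) (N : nat) (i : I) :
  P i -> \big[minn/N]_(j | P j) F j <= F i.
Proof.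
move=> Pi; have := mem_index_enum i; elim: (index_enum I) => // j r IHr.
rewrite inE big_cons => /orP[/eqP<-|/IHr le_i]; first by rewrite Pi geq_minl.
by case: (P j) => //; apply: leq_trans (geq_minr _ _) le_i.
Qed.

Lemma edist2 (G : sgraph) (x y v : G) :
  edist [set x; y] v = minn (dist x v) (dist y v).
Proof.
apply/eqP; rewrite eqn_leq leq_min !bigminn_le ?set21 ?set22 //=.
rewrite /edist; elim/big_ind: _ => [|m p hm hp|z].
- by rewrite geq_min dist_le.
- by rewrite leq_min hm.
- by rewrite !inE geq_min => /orP[] /eqP->; rewrite leqnn ?orbT.
Qed.

Lemma dist0 (G : sgraph) (x y : G) : (dist x y == 0) = (x == y).
Proof.
rewrite /dist; set a := fun k : nat => _.
have -> : (x == y) = a 0.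
  apply/idP/existsP => [xy|[p]]; first by exists [tuple]; rewrite /gpath /= xy.
  by rewrite (tuple0 p) /gpath /=.
have : 0 < #|G| by apply/card_gt0P; exists x.
by case: #|G| => // m _; rewrite [find _ _]/=; case: (a 0).
Qed.

Lemma edge_metric_generatorT (G : sgraph) : edge_metric_generator [set: G].
Proof.
suff sep (e f : {set G}) : e \in edges G -> f \in edges G ->
    (forall v, edist e v = edist f v) -> e \subset f.
  apply/forall_inP=> e eE; apply/forall_inP=> f fE; apply/implyP.
  apply: contraR => /exists_inPn h.
  have {}h v : edist e v = edist f v by have /negPn/eqP := h v (in_setT v).
  by rewrite eqEsubset !sep.
move=> /imsetP[[x y] /= _ ->] /imsetP[[z w] /= _ ->] h.
apply/subsetP => u uE; have := h u; rewrite !edist2.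
have -> : minn (dist x u) (dist y u) = 0.
  have uu : dist u u = 0 by apply/eqP; rewrite dist0.
  by move: uE; rewrite !inE => /orP[] /eqP<-; rewrite uu ?min0n ?minn0.
move/esym/eqP; rewrite !inE /minn.
by case: ifP => _; rewrite dist0 eq_sym => ->; rewrite ?orbT.
Qed.

Lemma edimP (G : sgraph) :
  (exists2 S : {set G}, edge_metric_generator S & edim G = #|S|) /\
  forall S : {set G}, edge_metric_generator S -> edim G <= #|S|.
Proof.
split; last by move=> S hS; apply: bigminn_le.
rewrite /edim; elim/big_ind: _ => [|m p [S ? ->] [S' ? ->]|S].
- by exists setT; rewrite ?cardsT //; exact: edge_metric_generatorT.
- by rewrite /minn; case: ifP => _; [exists S|exists S'].
- by exists S.
Qed.

(* Main.v *)
Require Import Defs.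
From mathcomp Require Import all_boot.
From mathcomp Require Import zify.

Set Implicit Arguments.
Unset Strict Implicit.
Unset Printing Implicit Defensive.

(** An edge of the subdivision graph is a half-edge: an original vertex [u],
    its base, together with the midpoint of an original edge [e] containing
    [u].  It is known as soon as one knows, for every original vertex [w],
    whether [w] is its base and whether [w] lies on [e].  One vertex [r] may
    even be left out, because a half-edge has exactly one base and [e] has
    exactly two ends ([half_edge_determined]).

    A landmark at an original vertex [w] sees distance 0 when [w] is the base
    and distance at most 1 when [w] lies on [e], which is all that is needed
    about [w] ([edist_vertex]).  The saving comes from the disjoint paths: for
    a path [a; b; c], the two midpoints of its edges settle both questions for
    all three of its vertices ([path_resolves]).  Indeed the distance from the
    midpoint of an edge [f], truncated at 3, tells whether [e = f], whether the
    base lies on [f] and whether [e] meets [f] ([edist_midpoint]), and for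
    [f = ab] and [f = bc] these six answers determine the position of the
    half-edge with respect to [a], [b] and [c] ([path_decode]).

    With [k = (n - 1) %/ 3] paths at least one vertex [r] is on none of them.
    The generator consists of the [2 * k] midpoints on the paths and of the
    [n - 3 * k - 1] remaining vertices other than [r], hence has at most
    [n - k - 1] elements, which is the announced ceiling. *)

(** * Small distances *)

(** Simple paths can be replaced by arbitrary walks, since a walk shortens to a
    simple path; the bound on [k] keeps the search in [dist] within its range. *)
Lemma dist_leP (G : sgraph) (x y : G) (k : nat) : k < #|G| ->
  reflect (exists p, [/\ path adj x p, last x p = y & size p <= k])
          (dist x y <= k).
Proof.
move=> ltkG; rewrite /dist; set a := fun j : nat => _.
apply: (iffP idP) => [le_k | [p [pp lp sp]]].
  have ha : has a (iota 0 #|G|).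
    by rewrite has_find size_iota (leq_ltn_trans le_k).
  have := nth_find 0 ha; rewrite nth_iota ?add0n ?(leq_ltn_trans le_k) //.
  case/existsP=> p /andP[/andP[_ pp] /eqP lp].
  by exists p; rewrite size_tuple.
case: (shortenP pp) lp => q pq uq sub_qp lq.
have /andP[_ uq'] := uq.
have sqk : size q <= k := leq_trans (uniq_leq_size uq' sub_qp) sp.
rewrite leqNgt; apply/negP => lt_find.
have := before_find 0 (leq_ltn_trans sqk lt_find).
rewrite nth_iota ?add0n ?(leq_ltn_trans sqk) // => /existsP[].
by exists (in_tuple q); rewrite lq eqxx andbT; apply/andP.
Qed.

Lemma dist_le1 (G : sgraph) (x y : G) : 1 < #|G| ->
  (dist x y <= 1) = (x == y) || adj x y.
Proof.
move=> hG; apply/(dist_leP _ _ hG)/idP.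
  case=> -[|z [|? ?]] [] //= pp <- _; first by rewrite eqxx.
  by move: pp; rewrite andbT => ->; rewrite orbT.
by case/orP=> [/eqP<- | xy]; [exists [::] | exists [:: y]; rewrite /= xy].
Qed.

Lemma dist_le2 (G : sgraph) (x y : G) : 2 < #|G| ->
  (dist x y <= 2) = [|| x == y, adj x y | [exists z, adj x z && adj z y]].
Proof.
move=> hG; apply/(dist_leP _ _ hG)/idP.
  case=> -[|z [|t [|? ?]]] [] //= pp <- _; first by rewrite eqxx.
    by move: pp; rewrite andbT => ->; rewrite orbT.
  by rewrite andbT in pp; apply/or3P/Or33/existsP; exists z.
case/or3P=> [/eqP<- | xy | /existsP[z /andP[xz zy]]]; first by exists [::].
- by exists [:: y]; rewrite /= xy.
by exists [:: z; y]; rewrite /= xz zy.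
Qed.

(** * Half-edges and what a landmark sees of them *)

Section HalfEdges.

Variable G : sgraph.
Local Notation edge := {e : {set G} | e \in edges G}.
Implicit Types (u v w : G) (e f : edge).

Definition half_edge u e : {set subdivision G} :=
  [set (inl u : subdivision G); (inr e : subdivision G)].

Lemma edges_subdivisionP (h : {set subdivision G}) :
  h \in edges (subdivision G) -> exists u e, u \in val e /\ h = half_edge u e.
Proof.
case/imsetP=> -[[u|e] [v|f]] //= ue ->; first by exists u, f.
by exists v, e; split=> //; rewrite setUC.
Qed.

Lemma edge_other_end u e :
  u \in val e -> exists2 v, u != v & val e = [set u; v].
Proof.
case: e => e /= eE; case/imsetP: (eE) => -[x y] /=; rewrite inE /= => xy ->.
have nxy : x != y by apply: contraTneq xy => ->; rewrite adj_irrefl.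
rewrite !inE => /orP[] /eqP->; first by exists y.
by exists x; rewrite 1?eq_sym // setUC.
Qed.

(** Discharges the side conditions of [dist_le1] and [dist_le2]. *)
Lemma card_subdivision_gt2 u e : u \in val e -> 2 < #|subdivision G|.
Proof.
move=> /edge_other_end[v nuv _].
by apply/card_gt2P; exists (inl u), (inl v), (inr e).
Qed.

Lemma eq_edge e a b : a != b ->
  (val e == [set a; b]) = (a \in val e) && (b \in val e).
Proof.
move=> nab; apply/eqP/andP => [-> | [ae be]]; first by rewrite !inE !eqxx orbT.
apply/esym/eqP; rewrite eqEcard cards2 nab; apply/andP; split.
  by apply/subsetP=> w /set2P[] ->.
by have [v nav ->] := edge_other_end ae; rewrite cards2 nav.
Qed.

(** Walks in the subdivision alternate between vertices and midpoints, so
    from [w] the base is reached at distance 0 and the midpoint at distance 1,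
    or not at all within distance 1. *)
Lemma edist_vertex u e w : u \in val e ->
  let d := edist (half_edge u e) (inl w : subdivision G) in
  (d <= 0) = (u == w) /\ (d <= 1) = (w \in val e).
Proof.
move=> ue /=; have G1 := ltnW (card_subdivision_gt2 ue).
rewrite edist2; split.
  by rewrite geq_min !leqn0 !dist0 orbF.
rewrite geq_min !dist_le1 //= !orbF.
by apply/orP/idP => [[/eqP[<-]|]|] //; right.
Qed.

(** From the midpoint of [ab], distance 0 reaches only [e = ab], distance 1
    only the ends of [ab], and distance 2 the midpoints of the edges sharing an
    end with [ab].  Equality with [ab] is expressed by membership of both ends,
    so that everything is phrased in terms of vertices. *)
Lemma edist_midpoint u e f a b : u \in val e -> a != b -> val f = [set a; b] ->
  let d := edist (half_edge u e) (inr f : subdivision G) in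
  [/\ (d <= 0) = (a \in val e) && (b \in val e),
     (d <= 1) = (u == a) || (u == b)
   & (d <= 2) = (a \in val e) || (b \in val e)].
Proof.
move=> ue nab fab /=; have G2 := card_subdivision_gt2 ue; have G1 := ltnW G2.
have mem_f w : (w \in val f) = (w == a) || (w == b) by rewrite fab !inE.
have eqef : (inr e == inr f :> subdivision G) = (a \in val e) && (b \in val e).
  by rewrite -eq_edge // -fab val_eqE.
rewrite edist2; split.
- by rewrite geq_min !leqn0 !dist0 /= eqef.
- rewrite geq_min !dist_le1 //= eqef orbF mem_f.
  case: andP => [[ae be]|_]; last by rewrite orbF.
  have ef : e = f by apply/val_inj/eqP; rewrite fab eq_edge // ae.
  by rewrite -mem_f -ef ue.
- rewrite geq_min !dist_le2 //= eqef.
  apply/idP/idP => [|abe]; last first.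
    apply/orP; right; apply/orP; right; apply/existsP.
    by case/orP: abe => we; [exists (inl a)|exists (inl b)];
      rewrite /= we mem_f eqxx ?orbT.
  case/orP=> [/orP[]|/orP[/andP[->]|]] //.
  + by rewrite mem_f => /orP[] /eqP<-; rewrite ue ?orbT.
  + by case/existsP=> -[w|g] //=; rewrite ?andbF.
  + case/existsP=> -[w|g] //= /andP[we]; rewrite mem_f.
    by case/orP=> /eqP<-; rewrite we ?orbT.
Qed.

(** Formulas reading the position of the half-edge off the answers of the two
    midpoints.  The base is [b] when it lies on both edges, [a] when only on
    the first.  For the ends of [e], the one ambiguity is that both [ab] and
    [bc] are met without being equal to [e]: then either [e] contains [b]
    alone, or [e = ac].  In the latter case the base is [a] or [c], so it lies
    on exactly one of [ab] and [bc]; in the former it is [b] or lies off the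
    path, and then [f1 = g1]. *)
Lemma path_decode a b c u e : uniq [:: a; b; c] -> u \in val e ->
  let A := a \in val e in let B := b \in val e in let C := c \in val e in
  let f1 := (u == a) || (u == b) in let g1 := (u == b) || (u == c) in
  [/\ (u == a) = f1 && ~~ g1, (u == b) = f1 && g1 & (u == c) = g1 && ~~ f1] /\
  [/\ B = [|| A && B, B && C | [&& A || B, B || C & f1 == g1]],
      A = A && B || (A || B) && ~~ B & C = B && C || (B || C) && ~~ B].
Proof.
rewrite /= !inE andbT negb_or => /andP[/andP[nab nac] nbc].
case/edge_other_end=> v nuv ->; rewrite !inE ![_ == u]eq_sym ![_ == v]eq_sym.
have excl (x y z : G) : x != y -> ~~ ((z == x) && (z == y)).
  by apply: contra => /andP[/eqP<- /eqP<-].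
(* Only pairwise exclusions between equalities matter from here on; what
   remains is a truth table in the positions of u and v. *)
have /and3P : [&& ~~ ((a == u) && (a == v)), ~~ ((b == u) && (b == v))
               & ~~ ((c == u) && (c == v))] by rewrite !excl.
rewrite ![_ == u]eq_sym ![_ == v]eq_sym.
move: (excl a b u nab) (excl a c u nac) (excl b c u nbc).
move: (excl a b v nab) (excl a c v nac) (excl b c v nbc).
case: (u == a); case: (u == b); case: (u == c) => //;
by case: (v == a); case: (v == b); case: (v == c) => // _ _ _ _ _ _ [].
Qed.

Lemma path_resolves a b c f g u e u' e' :
  uniq [:: a; b; c] -> val f = [set a; b] -> val g = [set b; c] ->
  u \in val e -> u' \in val e' ->
  (forall m, m \in [:: f; g] ->
     edist (half_edge u e) (inr m : subdivision G)
     = edist (half_edge u' e') (inr m : subdivision G)) ->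
  forall w, w \in [:: a; b; c] ->
    (u == w) = (u' == w) /\ (w \in val e) = (w \in val e').
Proof.
move=> Uabc fE gE ue u'e' sep.
have [[Ua Ub Uc] [Be Ae Ce]] := path_decode Uabc ue.
have [[Ua' Ub' Uc'] [Be' Ae' Ce']] := path_decode Uabc u'e'.
have [nab nbc] : a != b /\ b != c.
  by move: Uabc; rewrite /= !inE negb_or andbT => /andP[/andP[-> _] ->].
have [F0 F1 F2] := edist_midpoint ue nab fE.
have [F0' F1' F2'] := edist_midpoint u'e' nab fE.
have [G0 G1 G2] := edist_midpoint ue nbc gE.
have [G0' G1' G2'] := edist_midpoint u'e' nbc gE.
rewrite sep ?mem_head // F0' in F0; rewrite sep ?mem_head // F1' in F1.
rewrite sep ?mem_head // F2' in F2.
have gfg : g \in [:: f; g] by rewrite !inE eqxx orbT.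
rewrite sep // G0' in G0; rewrite sep // G1' in G1; rewrite sep // G2' in G2.
have BB : (b \in val e) = (b \in val e').
  by rewrite Be Be' -F0 -F1 -F2 -G0 -G1 -G2.
move=> w; rewrite !inE => /or3P[] /eqP->.
- by rewrite Ua Ua' Ae Ae' -F0 -F1 -F2 -G1 BB.
- by rewrite Ub Ub' -F1 -G1.
- by rewrite Uc Uc' Ce Ce' -G0 -F1 -G2 -G1 BB.
Qed.

(** The base is recovered by elimination, and whether [r] is an end of [e] by
    counting the ends of [e] other than [r]. *)
Lemma half_edge_determined r u e u' e' : u \in val e -> u' \in val e' ->
  (forall w, w != r -> (u == w) = (u' == w) /\ (w \in val e) = (w \in val e')) ->
  half_edge u e = half_edge u' e'.
Proof.
move=> ue u'e' same.
have -> : u = u'.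
  have [ur|/same[]] := eqVneq u r; last by rewrite eqxx => /esym/eqP.
  by have [->|/same[]] := eqVneq u' r; last by rewrite eqxx => /eqP.
suff -> : e = e' by [].
have same_off : val e :\ r = val e' :\ r.
  by apply/setP=> w; rewrite !inE; case: eqVneq => // /same[_ ->].
have two x (h : edge) : x \in val h -> #|val h| = 2.
  by case/edge_other_end=> y nxy ->; rewrite cards2 nxy.
have same_r : (r \in val e) = (r \in val e').
  have := two _ _ ue; rewrite -(two _ _ u'e') (cardsD1 r) [RHS](cardsD1 r).
  by rewrite same_off => /addIn; do 2!case: (r \in _).
apply/val_inj/setP=> w; have [->//|/same[_ ->] //] := eqVneq w r.
Qed.

(** * The generator *)

Definition first_edge (p : 3.-tuple G) : {set G} :=
  [set tnth p ord0; tnth p (inord 1)].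
Definition second_edge (p : 3.-tuple G) : {set G} :=
  [set tnth p (inord 1); tnth p (inord 2)].

(** The bridge between the tuples [P i] and the form of path used in
    [path_resolves], where the edges have to be vertices of the subdivision. *)
Lemma path2P (p : 3.-tuple G) : gpath p -> exists a b c (f g : edge),
  [/\ p = [:: a; b; c] :> seq G, uniq [:: a; b; c],
     val f = [set a; b] /\ val f = first_edge p
   & val g = [set b; c] /\ val g = second_edge p].
Proof.
rewrite /first_edge /second_edge.
case: p => -[|a [|b [|c []]]] //= sz /andP[Uabc /= /and3P[ab bc _]].
have edge_of x y : adj x y -> exists f : edge, val f = [set x; y].
  move=> xy; have xyE : [set x; y] \in edges G by apply/imsetP; exists (x, y).
  by exists (exist _ [set x; y] xyE).
have [f fE] := edge_of _ _ ab; have [g gE] := edge_of _ _ bc.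
exists a, b, c, f, g.
by split=> //; rewrite !(tnth_nth a) /= ?inordK.
Qed.

Section Generator.

Variables (k : nat) (P : 'I_k -> 3.-tuple G) (r : G).
Hypothesis gpathP : forall i, gpath (P i).
Hypothesis disjointP : forall i j, i != j -> [disjoint P i & P j].

Definition covered : {set G} := [set tnth (P ij.1) ij.2 | ij : 'I_k * 'I_3].

Definition path_edges : {set {set G}} :=
  [set first_edge (P i) | i : 'I_k] :|: [set second_edge (P i) | i : 'I_k].

Definition generator : {set subdivision G} :=
  [set inl w | w in ~: covered :\ r]
  :|: [set inr f | f : edge & val f \in path_edges].

Lemma card_covered : #|covered| = 3 * k.
Proof.
rewrite card_imset ?card_prod ?card_ord 1?mulnC // => -[i x] [j y] /= eq_t.
have ij : i = j.
  apply/eqP/negPn/negP=> /disjointP/disjointFr/(_ (mem_tnth x (P i))).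
  by rewrite eq_t mem_tnth.
have /andP[/tuple_uniqP inj_tnth _] := gpathP i.
by rewrite -ij in eq_t *; rewrite (inj_tnth _ _ eq_t).
Qed.

(** Each path trades its three vertices for two midpoints, and [r] is saved on
    top of that. *)
Lemma card_generator : r \notin covered -> #|generator| + k + 1 <= #|G|.
Proof.
move=> rU.
have cardW : #|~: covered :\ r| + 3 * k + 1 = #|G|.
  rewrite -(cardsC covered) card_covered (cardsD1 r (~: _)) inE rU; lia.
have cardE : #|path_edges| <= 2 * k.
  have le_k (F : 'I_k -> {set G}) : #|[set F i | i : 'I_k]| <= k.
    by rewrite -[leqRHS]card_ord leq_imset_card.
  rewrite mul2n -addnn; apply: leq_trans (leq_card_setU _ _) _.
  exact: leq_add (le_k _) (le_k _).
have : #|generator| <= #|~: covered :\ r| + #|path_edges|.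
  apply: leq_trans (leq_card_setU _ _) (leq_add (leq_imset_card _ _) _).
  apply: leq_trans (leq_imset_card _ _) _.
  rewrite -(card_imset _ val_inj).
  apply/subset_leq_card/subsetP=> _ /imsetP[f fE ->].
  by rewrite inE in fE.
lia.
Qed.

Lemma generatorP : edge_metric_generator generator.
Proof.
apply/forall_inP=> _ /edges_subdivisionP[u [e [ue ->]]].
apply/forall_inP=> _ /edges_subdivisionP[u' [e' [u'e' ->]]].
apply/implyP; apply: contraR => /exists_inPn same; apply/eqP.
have {}same z : z \in generator ->
  edist (half_edge u e) z = edist (half_edge u' e') z.
  by move=> /same/negPn/eqP.
apply: (half_edge_determined (r := r)) => // w wr.
have [/imsetP[[i x] _ /= ->]|wU] := boolP (w \in covered); last first.
  have wS : inl w \in generator.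
    by apply/setUP; left; apply: imset_f; rewrite !inE wr.
  have [<- <-] := edist_vertex w ue; have [<- <-] := edist_vertex w u'e'.
  by rewrite same.
have [a [b [c [f [g [Pi Uabc [fE fP] [gE gP]]]]]]] := path2P (gpathP i).
apply: (path_resolves Uabc fE gE) => //; last by rewrite -Pi mem_tnth.
move=> m; rewrite !inE => /orP[] /eqP->; apply: same; apply/setUP; right;
apply: imset_f; rewrite !inE ?fP ?gP; apply/orP; [left|right]; exact: imset_f.
Qed.

End Generator.
End HalfEdges.

Theorem theorem3 (G : sgraph) (n : nat) (cardG : #|G| = n)
    (connG : connected_graph G)
    (disjoint_paths : exists P : 'I_((n - 1) %/ 3) -> 3.-tuple G,
       (forall i, gpath (P i)) /\
       (forall i j, i != j -> [disjoint P i & P j])) :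
  edim (subdivision G) <= ceil_div (2 * n - 2) 3.
Proof.
have [P [gpathP disjointP]] := disjoint_paths.
have n0 : 0 < n by rewrite -cardG; case: connG.
have [r rU] : exists r, r \in ~: covered P.
  apply/card_gt0P; rewrite cardsCs setCK card_covered // cardG; lia.
rewrite inE in rU.
apply: leq_trans ((edimP _).2 _ (generatorP r gpathP)) _.
have := card_generator gpathP disjointP rU; rewrite cardG /ceil_div; lia.
Qed.
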